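(* Let $X\in S(M)$. Then $X$ is $\phi$-prime if and only if $S=M\setminus X$ is a $\phi$-$m$-system.
   Context: $R$ is an associative ring with identity, not necessarily commutative, and $M$ is a unitary right $R$-module. $S(M)$ is the set of all submodules of $M$; ''ideal'' means two-sided ideal. For a submodule $Y$ of $M$ and $I\subseteq R$, $YI$ is the set of finite sums of elements $yr$ with $y\in Y$, $r\in I$. $(X:_{R}M)=\{r\in R: Mr\subseteq X\}$. For a subset $T$ of $M$, $\langle T\rangle$ is the submodule generated by $T$. A function $\phi:S(M)\to S(M)\cup\{\emptyset\}$ is fixed, with the standing convention that $\phi(X)\subseteq X$ for every $X\in S(M)$. A submodule $X$ of $M$ is $\phi$-prime if it is proper and for every $Y\in S(M)$ and every ideal $I$ of $R$, $YI\subseteq X$ and $YI\nsubseteq\phi(X)$ imply $Y\subseteq X$ or $I\subseteq(X:_{R}M)$. A subset $S$ of $M$ is a $\phi$-$m$-system if $S\neq\emptyset$ and, writing $S^{c}=M\setminus S$, for all $Y_{1},Y_{2}\in S(M)$ and every ideal $I$ of $R$: if $(Y_{1}+Y_{2})\cap S\neq\emptyset$, $(Y_{1}+MI)\cap S\neq\emptyset$ and $Y_{2}I\nsubseteq\phi(\langle S^{c}\rangle)$, then $(Y_{1}+Y_{2}I)\cap S\neq\emptyset$. *)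

(* Defs.v *)
From mathcomp Require Import all_boot all_algebra.
From mathcomp Require Import boolp classical_sets.

Set Implicit Arguments.
Unset Strict Implicit.
Unset Printing Implicit Defensive.

Import GRing.Theory.

Local Open Scope ring_scope.
Local Open Scope classical_set_scope.

(* A right R-module is a left module over the converse ring R^c. The product
   of R^c is that of R with its arguments swapped, so that
   ract (ract m r) s = ract m (r * s), with the product taken in R. *)
Definition ract (R : pzRingType) (M : lmodType R^c) (m : M) (r : R) : M :=
  (r : R^c) *: m.

Definition is_submodule (R : pzRingType) (M : lmodType R^c) (X : set M) : Prop :=
  submod_closed [in X].

Record submodule (R : pzRingType) (M : lmodType R^c) := Submodule {
  submodule_set :> set M;
  submoduleP : is_submodule submodule_set
}.

Definition is_ideal (R : pzRingType) (I : set R) : Prop :=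
  zmod_closed [in I] /\ (forall a x, I x -> I (a * x) /\ I (x * a)).

Definition set_add (R : pzRingType) (M : lmodType R^c) (A B : set M) : set M :=
  [set x + y | x in A & y in B].

Definition set_ract (R : pzRingType) (M : lmodType R^c)
    (Y : set M) (I : set R) : set M :=
  [set m | exists (n : nat) (y : 'I_n -> M) (r : 'I_n -> R),
    [/\ forall i, Y (y i), forall i, I (r i)
      & m = \sum_(i < n) ract (y i) (r i)]].

Definition residual (R : pzRingType) (M : lmodType R^c) (X : set M) : set R :=
  [set r | forall m : M, X (ract m r)].

Lemma smallest_is_submodule (R : pzRingType) (M : lmodType R^c) (T : set M) :
  is_submodule (smallest (@is_submodule R M) T).
Proof.
split=> [|a u v /set_mem Tu /set_mem Tv]; apply/mem_set => A [subA TA].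
  by have [/set_mem A0 _] := subA.
have [_ Alin] := subA; apply/set_mem/Alin; apply/mem_set; [exact: Tu|exact: Tv].
Qed.

Definition submodule_gen (R : pzRingType) (M : lmodType R^c) (T : set M) :
  submodule M := Submodule (smallest_is_submodule T).

Definition phi_prime (R : pzRingType) (M : lmodType R^c)
    (phi : submodule M -> set M) (X : submodule M) : Prop :=
  (X : set M) <> [set: M] /\
  forall (Y : submodule M) (I : set R), is_ideal I ->
    set_ract Y I `<=` X -> ~ (set_ract Y I `<=` phi X) ->
    Y `<=` X \/ I `<=` residual X.

Definition phi_m_system (R : pzRingType) (M : lmodType R^c)
    (phi : submodule M -> set M) (S : set M) : Prop :=
  S !=set0 /\
  forall (Y1 Y2 : submodule M) (I : set R), is_ideal I ->
    set_add Y1 Y2 `&` S !=set0 ->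
    set_add Y1 (set_ract [set: M] I) `&` S !=set0 ->
    ~ (set_ract Y2 I `<=` phi (submodule_gen (~` S))) ->
    set_add Y1 (set_ract Y2 I) `&` S !=set0.

(* Main.v *)
Require Import Defs.
From mathcomp Require Import all_boot all_algebra.
From mathcomp Require Import boolp classical_sets.

(** Because [X] is a submodule, the submodule generated by the complement of
    [~` X] is [X] itself, so both conditions speak of the same [phi X]. The
    equivalence is then a contraposition. For a submodule [X], a sum [A + B] of
    two sets containing 0 meets [~` X] exactly when [A] or [B] is not contained
    in [X]; and [M I] is contained in [X] exactly when [I] is contained in
    [(X : M)].

    Let [X] be [phi]-prime and [Y2 I] not contained in [phi X]. If [Y1 + Y2 I]
    misses [~` X], then [Y1] and [Y2 I] lie in [X], so primeness puts [Y2] or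
    [M I] in [X], and with it [Y1 + Y2] or [Y1 + M I]. Conversely, let [Y I] not
    be contained in [phi X]. If neither [Y] lies in [X] nor [I] in [(X : M)], the
    m-system condition for [Y1 := X] and [Y2 := Y] gives an element of [X + Y I]
    outside [X], so [Y I] is not contained in [X]. *)

Import GRing.Theory.

Local Open Scope ring_scope.
Local Open Scope classical_set_scope.

Lemma submodule0 (R : pzRingType) (M : lmodType R^c) (X : set M) :
  is_submodule X -> X 0.
Proof. by case=> /set_mem. Qed.

Lemma submoduleD (R : pzRingType) (M : lmodType R^c) (X : set M) (x y : M) :
  is_submodule X -> X x -> X y -> X (x + y).
Proof.
case=> _ Xlin /mem_set Xx /mem_set Xy.
by have /set_mem := Xlin 1 x y Xx Xy; rewrite scale1r.
Qed.

Lemma submodule_sum (R : pzRingType) (M : lmodType R^c) (X : set M)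
    (n : nat) (f : 'I_n -> M) :
  is_submodule X -> (forall i, X (f i)) -> X (\sum_(i < n) f i).
Proof.
move=> subX Xf; elim/big_ind: _ => //; first exact: submodule0.
by move=> x y; exact: submoduleD.
Qed.

(** [submodule] carries a proof field, hence the appeal to proof irrelevance;
    equality of records is what is needed, since [phi] takes a record. *)
Lemma submodule_eq (R : pzRingType) (M : lmodType R^c) (X Y : submodule M) :
  (X : set M) = Y -> X = Y.
Proof.
case: X Y => [X subX] [Y subY] /= eqXY; rewrite -eqXY in subY *.
by congr Submodule; exact: Prop_irrelevance.
Qed.

Lemma submodule_gen_id (R : pzRingType) (M : lmodType R^c) (X : submodule M) :
  submodule_gen X = X.
Proof. by apply/submodule_eq/smallest_id/submoduleP. Qed.

Lemma set_ract0 (R : pzRingType) (M : lmodType R^c) (Y : set M) (I : set R) :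
  set_ract Y I 0.
Proof.
by exists 0%N, (fun=> 0), (fun=> 0); split=> [[]|[]|] //; rewrite big_ord0.
Qed.

Lemma mem_set_ract (R : pzRingType) (M : lmodType R^c) (Y : set M) (I : set R)
    (y : M) (r : R) :
  Y y -> I r -> set_ract Y I (ract y r).
Proof.
by move=> Yy Ir; exists 1%N, (fun=> y), (fun=> r); split=> //; rewrite big_ord1.
Qed.

Lemma set_ractT_sub (R : pzRingType) (M : lmodType R^c) (X : submodule M)
    (I : set R) :
  set_ract [set: M] I `<=` X <-> I `<=` residual X.
Proof.
split=> [MIX r Ir m|IX _ [n [y [r [_ Ir ->]]]]].
  by apply: MIX; exact: mem_set_ract.
by apply: submodule_sum => [|i]; [exact: submoduleP|exact: IX].
Qed.

(** [A] and [B] are subsets of [A + B] since both contain 0, while [X] is closed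
    under addition. *)
Lemma set_add_meetsC (R : pzRingType) (M : lmodType R^c) (X : submodule M)
    (A B : set M) :
  A 0 -> B 0 ->
  set_add A B `&` ~` X !=set0 <-> ~ (A `<=` X /\ B `<=` X).
Proof.
move=> A0 B0; split=> [[_ [[a Aa [b Bb <-]] nX]] [AX BX]|nAB].
  by apply: nX; apply: submoduleD; [exact: submoduleP|exact: AX|exact: BX].
apply: contrapT => noX; apply: nAB; split=> x xP; apply: contrapT => nXx.
  by apply: noX; exists x; split=> //; exists x => //; exists 0; rewrite ?addr0.
by apply: noX; exists x; split=> //; exists 0 => //; exists x; rewrite ?add0r.
Qed.

Theorem proposition4 (R : pzRingType) (M : lmodType R^c)
    (phi : submodule M -> set M)
    (phi_val : forall X : submodule M, is_submodule (phi X) \/ phi X = set0)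
    (phi_sub : forall X : submodule M, phi X `<=` X)
    (X : submodule M) :
  phi_prime phi X <-> phi_m_system phi (~` X).
Proof.
rewrite /phi_m_system setCK submodule_gen_id.
split=> [[Xproper Xprime]|[[x nXx] Xsys]].
  split=> [|Y1 Y2 I idI].
    by apply/set0P/eqP => XC0; apply: Xproper; rewrite -(setCK X) XC0 setC0.
  have Y10 := submodule0 _ _ _ (submoduleP Y1).
  have Y20 := submodule0 _ _ _ (submoduleP Y2).
  rewrite !set_add_meetsC //; try exact: set_ract0.
  move=> nY2 nMI nphi [Y1X Y2IX].
  have [Y2X|IX] := Xprime Y2 I idI Y2IX nphi; first exact: nY2.
  by apply: nMI; split=> //; exact/set_ractT_sub.
split=> [XT|Y I idI YIX nphi]; first by apply: nXx; rewrite XT.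
apply: contrapT => /not_orP[nY nI].
have X0 := submodule0 _ _ _ (submoduleP X).
have Y0 := submodule0 _ _ _ (submoduleP Y).
have := Xsys X Y I idI; rewrite !set_add_meetsC //; try exact: set_ract0.
apply=> //; [by case|by case=> _ /set_ractT_sub|by split].
Qed.
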